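(* If $G$ is a stepwise transmission irregular (STI) graph of order $n$ (number of vertices) and size $m$ (number of edges), then $$n+1 \le m \le \frac{n^2-1}{4}.$$ Moreover, the left equality holds if and only if $G \cong G_n$, and the right equality holds if and only if $G \cong K_{\frac{n-1}{2},\frac{n+1}{2}}$.
   Context: All graphs are simple and connected. The distance $d_G(u,v)$ is the number of edges on a shortest $u,v$-path. The transmission $\mathrm{Tr}_G(v)$ of a vertex $v$ is the sum of the distances between $v$ and all other vertices of $G$. A graph $G$ is stepwise transmission irregular (STI) if $|\mathrm{Tr}_G(u)-\mathrm{Tr}_G(v)|=1$ for every edge $uv\in E(G)$. $K_{p,q}$ denotes the complete bipartite graph with parts of sizes $p$ and $q$. For $n\ge 5$, the graph $G_n$ (hatted cycle) has vertex set $\{v_1,\ldots,v_n\}$, where $v_1,\ldots,v_{n-1}$ (in this cyclic order) induce a cycle of length $n-1$, and $v_n$ is adjacent exactly to $v_1$ and $v_3$.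
   Formalization: The lower bound n+1 ≤ m and its equality case are stated for n ≥ 5, where G_n is defined; the only STI graphs this excludes are K_1 (m=0) and K_{1,2} (n=3, m=2), both of which violate n+1 ≤ m. *)

(* Defs.v *)
From mathcomp Require Import all_boot all_order all_algebra.

Set Implicit Arguments.
Unset Strict Implicit.
Unset Printing Implicit Defensive.

Import Order.TTheory GRing.Theory Num.Theory.

Section Graph.
Variables (T : finType) (e : rel T).

Definition simple_graph : Prop := symmetric e /\ irreflexive e.

(* The graph with no vertices is not regarded as connected. *)
Definition connected_graph : Prop :=
  (0 < #|T|)%N /\ forall x y : T, connect e x y.

Definition edges : {set {set T}} :=
  [set [set x; y] | x in T, y in T & e x y].

(* A path starting at x with k edges is a duplicate-free x :: p with
   size p = k, so k < #|T|; the default value #|T| of the minimum is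
   returned only when y is not reachable from x. *)
Definition dist (x y : T) : nat :=
  \big[minn/#|T|]_(p : #|T|.-bseq T
      | [&& path e x p, uniq (x :: p) & last x p == y]) size p.

Definition transmission (v : T) : nat := \sum_(u : T | u != v) dist v u.

Definition sti : Prop :=
  forall u v : T, e u v ->
    (`|(transmission u)%:Z - (transmission v)%:Z| = 1)%R.

End Graph.

Definition isomorphic (T T' : finType) (e : rel T) (e' : rel T') : Prop :=
  exists2 f : T -> T', bijective f & forall x y, e' (f x) (f y) = e x y.

Definition complete_bipartite (p q : nat) : rel ('I_p + 'I_q) :=
  fun x y => match x, y with
             | inl _, inr _ | inr _, inl _ => true
             | _, _ => false
             end.
Arguments complete_bipartite : clear implicits.

(* Vertex i : 'I_n stands for v_(i+1): the values 0, ..., n - 2 form the cycle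
   and n - 1 is the hat v_n, adjacent to v_1 and v_3.  This is the intended
   graph only for 5 <= n. *)
Definition hatted_cycle (n : nat) : rel 'I_n :=
  let cyc (i j : nat) :=
    [&& i < n.-1, j < n.-1 & j == i.+1 %% n.-1] in
  let hat (i j : nat) := (i == n.-1) && ((j == 0) || (j == 2)) in
  fun i j => [|| cyc i j, cyc j i, hat i j | hat j i].
Arguments hatted_cycle : clear implicits.

(* Main.v *)
(* For an edge uv let W(u,v) be the set of vertices closer to u than to v. Along
   an edge the parity of the transmission changes, so G is bipartite, the sets
   W(u,v) and W(v,u) partition V, and Tr(v) - Tr(u) = |W(u,v)| - |W(v,u)|. Hence
   n = 2k+1 is odd and all these sets have k or k+1 elements, which gives the
   upper bound at once, and, for n >= 5, excludes vertices of degree 1.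

   Let x, y be two neighbours of a vertex s. By descent towards s, a vertex of
   W(x,s) :&: W(y,s) lies above some vertex with two neighbours nearer to s, and
   the sum over v <> s of (number of neighbours nearer to s) - 1 is m - n + 1.

   If m = n, all degrees are 2 and |W(x,s) :&: W(y,s)| <= 1; this contradicts
   |W(x,s)| = |W(y,s)| = k+1 at a vertex s of maximal transmission.

   If m = n+1, take s of degree at least 3. Then two of any three neighbours x,
   y, l of s satisfy |W(x,s) :&: W(y,s)| <= 1, so W(x,s) and W(y,s) cover all
   vertices but s and l. A second neighbour z of l is thus adjacent to x or y,
   which closes a 4-cycle; size considerations show that s and z have degree 3
   and that all other degrees are 2. A maximal path from z avoiding the
   rest of the 4-cycle returns to s and exhausts G, so G is a hatted cycle. *)

Require Import Defs.
From mathcomp Require Import all_boot all_order all_algebra.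
From mathcomp Require Import zify.

Set Implicit Arguments.
Unset Strict Implicit.
Unset Printing Implicit Defensive.

Import Order.TTheory GRing.Theory Num.Theory.

(** * Minima of natural numbers over a list *)

Lemma bigminn_le (I : eqType) (r : seq I) (P : pred I) (F : I -> nat) x0 j :
  j \in r -> P j -> \big[minn/x0]_(i <- r | P i) F i <= F j.
Proof.
elim: r => // i r IH; rewrite inE big_cons => /predU1P[<- -> | jr Pj].
  exact: geq_minl.
by case: ifP => _; rewrite ?geq_min IH ?orbT.
Qed.

Lemma bigminn_attained (I : eqType) (r : seq I) (P : pred I) (F : I -> nat) x0 :
  \big[minn/x0]_(i <- r | P i) F i < x0 ->
  exists2 j, P j & F j = \big[minn/x0]_(i <- r | P i) F i.
Proof.
elim: r => [|i r IH]; first by rewrite big_nil ltnn.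
rewrite big_cons; case: ifP => // Pi.
case: (leqP (F i)) => [_ _ | _ lt0]; [by exists i | exact: IH lt0].
Qed.

(** * Darts, isomorphisms, and the dart counts of the two extremal graphs *)

(** Darts are oriented edges, two per edge. Being pairs, they are easier to count and to transport
    along a bijection than two-element sets. *)
Definition darts (T : finType) (e : rel T) := [set p : T * T | e p.1 p.2].

Lemma card_darts_iso (T T' : finType) (e : rel T) (e' : rel T') :
  isomorphic e e' -> #|darts e| = #|darts e'|.
Proof.
case=> f [g fK gK] fe; pose h (p : T * T) := (f p.1, f p.2).
have h_inj : injective h by move=> [x y] [x' y'] [/(can_inj fK)-> /(can_inj fK)->].
rewrite -(card_imset _ h_inj); apply: eq_card => -[x y]; rewrite inE /=.
apply/imsetP/idP => [[[u v] + [-> ->]]|xy]; first by rewrite inE fe.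
by exists (g x, g y); rewrite /h ?inE /= ?gK // -fe !gK.
Qed.

Lemma isomorphic_can (T T' : finType) (e : rel T) (e' : rel T') (g : T' -> T) :
  bijective g -> (forall i j, e (g i) (g j) = e' i j) -> isomorphic e e'.
Proof. by case=> f gK fK ge; exists f; [exists g | move=> x y; rewrite -ge !fK]. Qed.

(** A bijection preserving edges in one direction injects darts into darts; equal finite counts make
    this map onto, so edges are reflected as well. *)
Lemma isomorphic_card_darts (T T' : finType) (e : rel T) (e' : rel T') (g : T' -> T) :
    bijective g -> (forall i j, e' i j -> e (g i) (g j)) -> #|darts e| = #|darts e'| ->
  isomorphic e e'.
Proof.
move=> g_bij ge eq_darts; apply: (isomorphic_can g_bij) => i j.
have g_inj := bij_inj g_bij; pose h (p : T' * T') := (g p.1, g p.2).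
have h_inj : injective h by move=> [x y] [x' y'] [/g_inj-> /g_inj->].
have hE : h @: darts e' = darts e.
  apply/eqP; rewrite eqEcard card_imset // eq_darts leqnn andbT.
  by apply/subsetP => _ /imsetP[[x y] + ->]; rewrite !inE /=; apply: ge.
have <- : (h (i, j) \in h @: darts e') = e' i j by rewrite mem_imset // inE.
by rewrite hE inE.
Qed.

Lemma card_darts_complete_bipartite p q :
  #|darts (complete_bipartite p q)| = (p * q).*2.
Proof.
pose L := [set (inl i : 'I_p + 'I_q) | i in 'I_p].
have cL : #|L| = p by rewrite card_imset ?card_ord // => i j [].
have cR : #|~: L| = q.
  by apply/eqP; rewrite -(eqn_add2l #|L|) cardsC card_sum !card_ord cL.
have inL (x : 'I_p + 'I_q) : (x \in L) = if x is inl _ then true else false.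
  case: x => i; first by rewrite imset_f.
  by apply/imsetP => -[].
have -> : darts (complete_bipartite p q) = setX L (~: L) :|: setX (~: L) L.
  by apply/setP => -[x y]; rewrite !inE /= !inL; case: x y => [i|i] [j|j].
rewrite cardsU !cardsX cL cR (_ : _ :&: _ = set0) ?cards0 ?subn0; last first.
  by apply/setP => -[x y]; rewrite !inE /= !inL; case: x y => [i|i] [j|j].
by rewrite (mulnC q) addnn.
Qed.

Lemma card_darts_hatted_cycle n : 5 <= n -> #|darts (hatted_cycle n)| = n.+1.*2.
Proof.
case: n => // N; rewrite ltnS => ge4.
pose cyc (i j : nat) := [&& i < N, j < N & j == i.+1 %% N].
pose hat (i j : nat) := (i == N) && ((j == 0) || (j == 2)).
(* [A] takes each edge in one orientation: forward around the cycle, or away from the hat. *)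
pose A := [set p : 'I_N.+1 * 'I_N.+1 | cyc p.1 p.2 || hat p.1 p.2].
pose swap (p : 'I_N.+1 * 'I_N.+1) := (p.2, p.1).
have lt2 : 2 < N.+1 by rewrite ltnS ltnW // ltnW.
have swapK : involutive swap by case.
have modS i : i < N -> i.+1 %% N = if i.+1 == N then 0 else i.+1.
  by case: eqP => [->|/eqP neq lt_i]; rewrite ?modnn // modn_small // ltn_neqAle neq.
have card_A : #|A| = N.+2.
  have -> : #|A| = \sum_(p : 'I_N.+1 * 'I_N.+1 | cyc p.1 p.2 || hat p.1 p.2) 1.
    by rewrite sum1dep_card.
  rewrite -(pair_big_dep predT (fun i j : 'I_N.+1 => cyc i j || hat i j) (fun _ _ => 1)) /=.
  (* The last row belongs to the hat and has two darts; each of the other [N] rows has one. *)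
  rewrite big_ord_recr /= [X in X + _](_ : _ = N); last first.
    rewrite -[RHS]card_ord -sum1_card; apply: eq_bigr => i _.
    rewrite sum1dep_card (_ : [set j | _] = [set inord (i.+1 %% N)]) ?cards1 //.
    have lt_mod : i.+1 %% N < N by rewrite ltn_mod (leq_trans _ ge4).
    apply/setP => j; rewrite !inE -val_eqE /= inordK ?ltnS ?(ltnW lt_mod) //.
    rewrite /cyc /hat ltn_ord [i == N :> nat]ltn_eqF ?ltn_ord // orbF /=.
    by case: eqP => [->|_]; rewrite ?lt_mod ?andbF.
  rewrite sum1dep_card (_ : [set j | _] = [set inord 0; inord 2]).
    by rewrite cards2 -val_eqE /= !inordK // addn2.
  apply/setP => j; rewrite !inE -!val_eqE /= !inordK //.
  by rewrite /cyc /hat ltnn eqxx.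
have mem_swap p : (p \in swap @: A) = (swap p \in A).
  by rewrite -{1}(swapK p) mem_imset //; exact: inv_inj.
have -> : darts (hatted_cycle N.+1) = A :|: swap @: A.
  apply/setP => -[i j]; transitivity [|| cyc i j, cyc j i, hat i j | hat j i].
    by rewrite inE.
  rewrite in_setU mem_swap !inE /=.
  by move: (cyc i j) (cyc j i) (hat i j) (hat j i) => [] [] [] [].
(* No dart of [A] has its reverse in [A], since the cycle length [N] is at least 4. *)
have disj : A :&: swap @: A = set0.
  have cycE i j : cyc i j -> i < N /\ j < N /\ (i.+1 = j \/ i.+1 = N /\ j = 0).
    case/and3P=> lt_i lt_j /eqP->; rewrite ltn_mod modS //.
    by move: (ltn_mod i.+1 N); case: eqP; move: lt_i ge4; clear; lia.
  have hatE i j : hat i j -> i = N /\ (j = 0 \/ j = 2).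
    by case/andP=> /eqP-> /orP[] /eqP->; auto.
  apply/setP => -[i j]; rewrite in_setI mem_swap !inE /=; apply/negP.
  move: (nat_of_ord i) (nat_of_ord j) => {}i {}j /andP[].
  by case/orP => [/cycE|/hatE] ij /orP[/cycE|/hatE] ji; move: ge4 ij ji; clear; lia.
rewrite cardsU disj cards0 subn0 card_imset ?card_A; last exact: inv_inj.
by rewrite addnn.
Qed.

(** * Elementary facts on sums and cardinals *)

Lemma sum_nat_gt0_ex (I : finType) (P : pred I) (F : I -> nat) :
  0 < \sum_(i | P i) F i -> exists2 i, P i & 0 < F i.
Proof. by rewrite lt0n sum_nat_eq0 => /forall_inPn[i Pi]; rewrite -lt0n; exists i. Qed.

Lemma le_sum_term (I : finType) (P : pred I) (F : I -> nat) i :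
  P i -> F i <= \sum_(i | P i) F i.
Proof. by move=> Pi; rewrite (bigD1 i) //= leq_addr. Qed.

Lemma cards3 (T : finType) (x y z : T) : x != y -> y != z -> x != z -> #|[set x; y; z]| = 3.
Proof.
move=> nxy nyz nxz; rewrite setUC cardsU1 cards2 nxy !inE negb_or.
by rewrite (eq_sym z x) (eq_sym z y) nxz nyz.
Qed.

(* [lia] can fail to identify occurrences of the same cardinal or sum. *)
Ltac card_lia :=
  repeat (let a := fresh "a" in move: (#|_|) => a);
  repeat (let a := fresh "a" in move: (\sum_(_ | _) _) => a);
  clear; lia.

(** * Shortest paths in a connected graph *)

Section Distance.
Variables (T : finType) (e : rel T).
Hypotheses (e_sym : symmetric e) (e_irr : irreflexive e).
Hypothesis e_conn : forall x y, connect e x y.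
Local Notation d := (dist e).

Lemma dist_le x p : path e x p -> d x (last x p) <= size p.
Proof.
move=> /shortenP[p' p'_path p'_uniq p'_sub].
have szp : size p' <= size p by apply: uniq_leq_size (p'_sub); case/andP: p'_uniq.
apply: leq_trans szp.
have szT : size p' <= #|T|.
  by have := max_card (mem (x :: p')); rewrite (card_uniqP p'_uniq) => /ltnW.
pose b : #|T|.-bseq T := Bseq szT.
rewrite /dist; apply: (bigminn_le (fun q : #|T|.-bseq T => size q) _ (j := b)).
  exact: mem_index_enum.
by rewrite /= p'_path eqxx andbT; exact: p'_uniq.
Qed.

Lemma dist_path x y : exists p, [/\ path e x p, last x p = y & size p = d x y].
Proof.
have /connectP[p0 /shortenP[p p_path p_uniq _] ->] := e_conn x y.
(* A duplicate-free path has fewer than [#|T|] edges, so the minimum lies below its default value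
   and is attained. *)
have lt_d : d x (last x p) < #|T|.
  apply: leq_ltn_trans (dist_le p_path) _.
  by have := max_card (mem (x :: p)); rewrite (card_uniqP p_uniq).
have [b /and3P[b_path _ /eqP b_last] b_size] := bigminn_attained lt_d.
by exists b.
Qed.

Lemma dist_eq0 x y : (d x y == 0) = (x == y).
Proof.
apply/eqP/eqP => [d0|->]; last by apply/eqP; rewrite -leqn0 (@dist_le y [::]).
by have [p [_ py]] := dist_path x y; rewrite d0 -py => /size0nil->.
Qed.

Lemma dist_sym x y : d x y = d y x.
Proof.
suff le x' y' : d x' y' <= d y' x' by apply/eqP; rewrite eqn_leq !le.
have [p [p_path <- <-]] := dist_path y' x'.
have := @dist_le (last y' p) (rev (belast y' p)).
rewrite rev_path (eq_path (e' := e)) => [/(_ p_path)|u v]; last exact: e_sym.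
rewrite size_rev size_belast; congr (d _ _ <= _).
by case: p {p_path} => //= z p; rewrite rev_cons last_rcons.
Qed.

Lemma dist_edge x y : e x y -> d x y = 1.
Proof.
move=> exy; have := @dist_le x [:: y]; rewrite /= exy => /(_ isT).
case: (posnP (d x y)) => [/eqP|]; last by case: (d x y) => [|[]].
by rewrite dist_eq0 => /eqP xy; rewrite xy e_irr in exy.
Qed.

Lemma dist1 x y : d x y = 1 -> e x y.
Proof.
have [p [p_path <- <-]] := dist_path x y.
by case: p p_path => [|z []] //= /andP[].
Qed.

Lemma dist_edge_le s x y : e x y -> d s y <= (d s x).+1.
Proof.
move=> exy; have [p [p_path p_last <-]] := dist_path s x.
have := @dist_le s (rcons p y); rewrite last_rcons size_rcons; apply.
by rewrite rcons_path p_path p_last.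
Qed.

Lemma dist_step s v : v != s -> exists2 u, e v u & d s v = (d s u).+1.
Proof.
have [p [p_path p_last p_size]] := dist_path s v.
case/lastP: p p_path p_last p_size => [_ /= ->|p u]; first by rewrite eqxx.
rewrite rcons_path last_rcons size_rcons => /andP[p_path eu] uv.
rewrite uv in eu * => p_size _; exists (last s p); first by rewrite e_sym.
apply/eqP; rewrite eqn_leq (dist_edge_le s eu) -p_size ltnS.
exact: dist_le.
Qed.

(** * Degrees and edge counts *)

Definition nbr (v : T) := [set u | e v u].
Definition deg v := #|nbr v|.
(** This is the set W(u,v). *)
Definition closer u v := [set x | d u x < d v x].
(** The number of possible first steps of a shortest path from [v] to [s]. *)
Definition down s v := #|[set u | e v u & d s u < d s v]|.

Lemma nbr_eq v (A : {set T}) : A \subset nbr v -> deg v <= #|A| -> nbr v = A.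
Proof. by move=> sA le; apply/esym/eqP; rewrite eqEcard sA. Qed.

Lemma sum_deg : \sum_v deg v = #|darts e|.
Proof.
have -> : #|darts e| = \sum_(p : T * T | e p.1 p.2) 1 by rewrite sum1dep_card.
rewrite -(pair_big_dep predT (fun x y => e x y) (fun _ _ => 1)) /=.
by apply: eq_bigr => v _; rewrite /deg /nbr sum1dep_card.
Qed.

Lemma card_darts : #|darts e| = #|edges e|.*2.
Proof.
pose f (p : T * T) := [set p.1; p.2].
have -> : edges e = f @: darts e.
  apply/setP => A; apply/imset2P/imsetP => [[x y _ + ->] | [[x y]]].
    by rewrite !inE /= => exy; exists (x, y); rewrite ?inE.
  by rewrite inE /= => exy ->; exists x y; rewrite ?inE.
rewrite -sum1_card (partition_big_imset f) /= -muln2 -sum_nat_const.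
apply: eq_bigr => A /imsetP[[x y]]; rewrite inE /= => exy ->.
have nxy : x != y by apply: contraTneq exy => ->; rewrite e_irr.
have /card_uniqP/esym : uniq [:: (x, y); (y, x)].
  by rewrite /= inE xpair_eqE negb_and nxy.
rewrite sum1dep_card => /= ->; apply: eq_card => -[u v].
rewrite !inE /= /f /= !xpair_eqE.
apply/andP/orP => [[euv /eqP/setP uv_xy] | [] /andP[/eqP-> /eqP->]].
- have := uv_xy u; have := uv_xy v; have := uv_xy x; have := uv_xy y.
  have nuv : u != v by apply: contraTneq euv => ->; rewrite e_irr.
  rewrite !inE !eqxx (negbTE nxy) (eq_sym y x) (negbTE nxy) /= ?orbT.
  move: nuv; rewrite (eq_sym x u) (eq_sym y u) (eq_sym x v) (eq_sym y v).
  by do !case: eqP => //= ?; subst; auto.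
- by rewrite exy.
- by rewrite e_sym exy setUC.
Qed.

Lemma sum_dist v : transmission e v = \sum_u d v u.
Proof.
rewrite /transmission [RHS](bigD1 v) //=.
by have /eqP-> : d v v == 0; rewrite ?dist_eq0.
Qed.

(** * Parity of transmissions and the sizes of the sets W(u,v) *)

Hypothesis e_sti : sti e.
Local Notation n := #|T|.
Local Notation Tr := (transmission e).

Lemma sti_edge u v : e u v -> Tr u = (Tr v).+1 \/ Tr v = (Tr u).+1.
Proof. by move=> /e_sti; lia. Qed.

(** The parity of the transmission flips along every edge of a shortest path from [u] to [v]. *)
Lemma odd_dist u v : odd (d u v) = odd (Tr u) (+) odd (Tr v).
Proof.
have [p [p_path <- <-]] := dist_path u v.
elim: p u p_path => [|x p IH] u /=; first by rewrite addbb.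
by case/andP => /sti_edge ux /IH->; case: ux => -> /=; rewrite ?addbN ?addNb ?negbK.
Qed.

Lemma dist_edge_neq s u v : e u v -> d s u != d s v.
Proof.
move=> /sti_edge uv; apply/eqP => /(congr1 odd); rewrite !odd_dist.
by case: uv => -> /=; do 2!case: odd.
Qed.

Lemma card_closer_sum u v : e u v -> #|closer u v| + #|closer v u| = n.
Proof.
move=> euv; rewrite -cardsUI -cardsT.
have -> : closer u v :&: closer v u = set0.
  by apply/setP => x; rewrite !inE; case: ltngtP.
rewrite cards0 addn0; apply: eq_card => x; rewrite !inE -neq_ltn.
by rewrite !(dist_sym _ x) dist_edge_neq.
Qed.

(** No [x] is equidistant from [u] and [v], so its two distances differ by exactly 1, and the sign
    tells which of the two sets contains [x]. Summing over [x] gives the identity. *)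
Lemma card_closer_Tr u v : e u v -> Tr u + #|closer u v| = Tr v + #|closer v u|.
Proof.
move=> euv; have cE a b : #|closer a b| = \sum_x (d a x < d b x).
  rewrite -sum1dep_card big_mkcond; apply: eq_bigr => x _.
  by case: ltnP.
rewrite !cE !sum_dist -!big_split; apply: eq_bigr => x _ /=.
rewrite !(dist_sym _ x); have := dist_edge_neq x euv.
have evu : e v u by rewrite e_sym.
by have := dist_edge_le x euv; have := dist_edge_le x evu; lia.
Qed.

(** The order is the sum of two cardinals that differ by |Tr(u) - Tr(v)| = 1. *)
Lemma odd_order u v : e u v -> odd n.
Proof.
move=> euv; rewrite -(card_closer_sum euv) oddD.
have /(congr1 odd) := card_closer_Tr euv; rewrite !oddD.
by have [->|->] := sti_edge euv; rewrite /=; do 3!case: odd.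
Qed.

Lemma card_closer_ge u v : e u v -> n <= #|closer u v|.*2.+1.
Proof.
move=> euv; have := card_closer_sum euv; have := card_closer_Tr euv.
by have [->|->] := sti_edge euv; lia.
Qed.

Lemma card_closer_max u v : e u v -> Tr u <= Tr v -> #|closer u v|.*2 = n.+1.
Proof.
move=> euv le_uv; have := card_closer_sum euv; have := card_closer_Tr euv.
by case: (sti_edge euv); lia.
Qed.

(** * Descent towards a vertex [s] *)

Lemma dist_nbr s u v : e s u -> e s v -> d u v < d s v -> u = v.
Proof.
move=> su sv; rewrite (dist_edge sv) ltnS leqn0 dist_eq0.
by move/eqP.
Qed.

(** The first step [p] of a shortest path from [v] to [x] works: since [d x v < d s v], it also
    starts a shortest path from [v] to [s] through [x]. *)
Lemma closer_step s x v : e s x -> v \in closer x s -> v != x ->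
  exists2 p, p \in closer x s & e v p /\ d s p < d s v.
Proof.
rewrite inE => sx lt_v /dist_step[p vp vE].
have [xs pv] : e x s /\ e p v by rewrite e_sym sx e_sym vp.
exists p; last by split=> //; have := dist_edge_le p xs; rewrite !(dist_sym p); lia.
by rewrite inE; have := dist_edge_le s pv; lia.
Qed.

Lemma down_uniq s v x y : down s v <= 1 -> e v x -> d s x < d s v ->
  e v y -> d s y < d s v -> x = y.
Proof.
move=> le1 vx sx vy sy; apply/eqP; apply: contraLR le1 => nxy.
rewrite -ltnNge -(_ : #|[set x; y]| = 2); last by rewrite cards2 nxy.
by apply/subset_leq_card/subsetP => u /set2P[]->; rewrite inE ?vx ?vy.
Qed.

(** If [v] has only one lower neighbour, the steps towards [x] and towards [y] coincide, so this
    neighbour lies in the intersection again. The vertices [s], [x], [y] are not in the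
    intersection, and [w] is never entered because all its neighbours are below it; hence the
    descent can stop only at [q]. *)
Lemma closer_inter s x y w q v : e s x -> e s y -> x != y ->
    (forall u, e w u -> d s u < d s w) ->
    (forall u, u != s -> u != w -> u != q -> down s u <= 1) ->
    v \in closer x s :&: closer y s -> v != w ->
  [/\ q \in closer x s :&: closer y s, d s q <= d s v & q != w].
Proof.
move=> sx sy nxy w_top down1.
have [k] := ubnP (d s v); elim: k v => // k IH v lt_v v_xy nvw.
have [<-|nvq] := eqVneq v q; first by split.
have [vx vy] := setIP v_xy.
have nvs : v != s by apply: contraTneq vx => ->; rewrite inE (eqP (_ : d s s == 0)) ?dist_eq0.
have nvx : v != x.
  by apply: contraNneq nxy => vE; rewrite vE inE in vy; rewrite (dist_nbr sy sx vy).
have nvy : v != y.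
  by apply: contraNneq nxy => vE; rewrite vE inE in vx; rewrite (dist_nbr sx sy vx).
have [p px [vp sp]] := closer_step sx vx nvx.
have [p' py [vp' sp']] := closer_step sy vy nvy.
have pE := down_uniq (down1 v nvs nvw nvq) vp sp vp' sp'; rewrite -pE in py.
have npw : p != w.
  apply/eqP => pw; have wv : e w v by rewrite -pw e_sym.
  by have := w_top v wv; rewrite -pw ltnNge ltnW.
have [|q_xy le_q nqw] := IH p (leq_trans sp lt_v) _ npw; first exact/setIP.
by split => //; exact: leq_trans le_q (ltnW sp).
Qed.

Lemma down_gt0 s v : v != s -> 0 < down s v.
Proof.
by move=> /dist_step[u vu sE]; apply/card_gt0P; exists u; rewrite inE vu sE /=.
Qed.

Lemma down_src s : down s s = 0.
Proof.
apply/eqP; rewrite cards_eq0; apply/eqP/setP => u; rewrite !inE.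
by rewrite (eqP (_ : d s s == 0)) ?dist_eq0 // ltn0 andbF.
Qed.

Lemma deg_down s v : deg v = down s v + #|[set u | e v u & d s v < d s u]|.
Proof.
rewrite -cardsUI [X in _ + X](_ : _ = 0) ?addn0; last first.
  apply/eqP; rewrite cards_eq0; apply/eqP/setP => u.
  by rewrite !inE; case: ltngtP; rewrite ?andbF.
apply: eq_card => u; rewrite !inE -andb_orr -neq_ltn.
by case vu: (e v u) => //=; rewrite eq_sym dist_edge_neq.
Qed.

(** Each edge has exactly one end farther from [s] and is counted there. *)
Lemma sum_down s : \sum_v down s v = #|edges e|.
Proof.
apply: double_inj; rewrite -card_darts -sum_deg (eq_bigr _ (fun v _ => deg_down s v)).
rewrite big_split /= -addnn; congr (_ + _).
have dE (P : rel T) : \sum_v #|[set u | P v u]| = \sum_v \sum_u (P v u : nat).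
  by apply: eq_bigr => v _; rewrite -sum1dep_card big_mkcond; apply: eq_bigr => u _; case: ifP.
rewrite /down !dE exchange_big; apply: eq_bigr => v _; apply: eq_bigr => u _.
by rewrite e_sym.
Qed.

(** * The upper bound and its equality case *)

Lemma connected_edge v : 1 < n -> exists u, e v u.
Proof.
move=> /card_gt1P[x [y [_ _ nxy]]].
have [z nzv] : exists z, z != v.
  by have [xv|] := eqVneq x v; [exists y; rewrite -xv eq_sym | exists x].
by have := nzv; rewrite eq_sym => /dist_step[u]; exists u.
Qed.

(** One class of the bipartition. *)
Definition odd_tr := [set v | odd (Tr v)].

Lemma edge_odd_tr u v : e u v -> (u \in odd_tr) != (v \in odd_tr).
Proof. by move=> /sti_edge uv; rewrite !inE; case: uv => -> /=; case: odd. Qed.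

Lemma darts_sub : darts e \subset setX odd_tr (~: odd_tr) :|: setX (~: odd_tr) odd_tr.
Proof.
apply/subsetP => -[u v]; rewrite inE /= => /edge_odd_tr.
by rewrite !inE /=; do 2!case: odd.
Qed.

Lemma card_cross (A : {set T}) :
  #|setX A (~: A) :|: setX (~: A) A| = (#|A| * (n - #|A|)).*2.
Proof.
rewrite cardsU !cardsX (_ : _ :&: _ = set0) ?cards0 ?subn0; last first.
  by apply/setP => -[u v]; rewrite !inE /=; case: (u \in A); rewrite /= ?andbF.
by rewrite -(cardsC A) addKn [X in _ + X]mulnC addnn.
Qed.

Lemma card_edges_le : #|edges e| <= #|odd_tr| * (n - #|odd_tr|).
Proof. by have := subset_leq_card darts_sub; rewrite card_cross card_darts leq_double. Qed.

Lemma odd_card : 0 < n -> odd n.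
Proof.
rewrite leq_eqVlt => /predU1P[<- //|n_gt1].
have /card_gt0P[v _] := ltnW n_gt1.
by have [u vu] := connected_edge v n_gt1; exact: odd_order vu.
Qed.

(** The two classes have different sizes because the order is odd, so the inequality of arithmetic
    and geometric means is strict. *)
Lemma card_edges_max : 0 < n -> #|edges e|.*2.*2.+1 <= n ^ 2.
Proof.
move=> /odd_card odd_n; have := card_edges_le; rewrite -(cardsC odd_tr) addKn.
have neq : #|odd_tr| != #|~: odd_tr|.
  by apply: contraTneq odd_n => cE; rewrite -(cardsC odd_tr) -cE addnn odd_double.
have := ltn_leqif (nat_AGM2 #|odd_tr| #|~: odd_tr|); rewrite neq.
by move: (#|odd_tr| * _) (_ ^ 2) (#|edges e|); clear; lia.
Qed.

Lemma isomorphic_complete_bipartite : #|edges e|.*2.*2.+1 = n ^ 2 ->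
  isomorphic e (complete_bipartite n.-1./2 n.+1./2).
Proof.
move=> m_eq; have n_gt0 : 0 < n by case: (posnP n) m_eq => // ->.
have [k nk] : exists k, n = k.*2.+1.
  by exists n./2; rewrite -[LHS]odd_double_half odd_card.
have [k1 k2] : n.-1./2 = k /\ n.+1./2 = k.+1 by rewrite nk -doubleS !doubleK.
(* Here m = k(k+1), which is the largest value of a(2k+1-a) and is attained only at a = k and a =
   k+1. *)
have [cO mO] : (#|odd_tr| = k \/ #|odd_tr| = k.+1) /\ #|edges e| = #|odd_tr| * (n - #|odd_tr|).
  move: card_edges_le (max_card (mem odd_tr)) m_eq; rewrite nk.
  move: (#|odd_tr|) (#|edges e|) => a m; rewrite expnS expn1; clear => le_m le_a mE.
  have [b nb] : exists b, k.*2.+1 = a + b by exists (k.*2.+1 - a); rewrite subnKC.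
  move: le_m mE; rewrite nb addKn.
  have [le_ak|lt_ka] := leqP a k.
    have [r kr] : exists r, k = a + r by exists (k - a); rewrite subnKC.
    have -> : b = a + r.*2.+1 by move: nb; rewrite kr; clear; lia.
    case: r {nb} kr => [|r] ->; nia.
  have [r ar] : exists r, a = k.+1 + r by exists (a - k.+1); rewrite subnKC.
  have kE : k = b + r by move: nb; rewrite ar; clear; lia.
  case: r kE ar {nb} => [|r] kE ->; nia.
have eE u v : e u v = ((u \in odd_tr) != (v \in odd_tr)).
  have := subset_cardP _ darts_sub; rewrite card_cross card_darts mO => /(_ erefl (u, v)).
  by rewrite !inE /= => ->; do 2!case: odd.
(* [P] is the smaller class, so that the parts come in the order of [complete_bipartite k k.+1]. *)
have [P [cP cP' PE]] : exists P : {set T}, [/\ #|P| = k, #|~: P| = k.+1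
    & forall u v, e u v = ((u \in P) != (v \in P))].
  have cC := cardsC odd_tr.
  case: cO => cO; [exists odd_tr | exists (~: odd_tr)]; split => //.
  - by apply/eqP; rewrite -(eqn_add2l k) -{1}cO cC nk -addnn -addnS.
  - by apply/eqP; rewrite -(eqn_add2l k.+1) -{1}cO cC nk -addnn addSn.
  - by rewrite setCK.
  - by move=> u v; rewrite eE !inE; do 2!case: odd.
have /card_gt0P[x0 _] := n_gt0.
pose g (i : 'I_k + 'I_k.+1) :=
  match i with inl i => nth x0 (enum P) i | inr j => nth x0 (enum (~: P)) j end.
have gP i : (g i \in P) = if i is inl _ then true else false.
  case: i => i /=; first by rewrite -mem_enum mem_nth // -cardE cP.
  have := mem_nth x0 (s := enum (~: P)) (n := i).
  by rewrite -cardE cP' ltn_ord => /(_ isT); rewrite mem_enum inE => /negbTE.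
have g_inj : injective g.
  move=> i j gij; have := gP i; rewrite gij gP; case: i j gij => [i|i] [j|j] //= + _.
    by move/eqP; rewrite nth_uniq ?enum_uniq -?cardE ?cP // => /eqP/val_inj->.
  by move/eqP; rewrite nth_uniq ?enum_uniq -?cardE ?cP' // => /eqP/val_inj->.
rewrite k1 k2; apply: (isomorphic_can (g := g)) => [|i j].
  by apply: inj_card_bij => //; rewrite card_sum !card_ord nk -addnn addnS.
by rewrite PE !gP; case: i j => [i|i] [j|j].
Qed.

(** * Excess sums and the lower bound *)

Lemma src_notin_closer s x : s \notin closer x s.
Proof. by rewrite inE (eqP (_ : d s s == 0)) ?dist_eq0. Qed.

Lemma deg_le_down s w u : deg w <= down s w -> e w u -> d s u < d s w.
Proof.
rewrite (deg_down s) -[X in _ <= X]addn0 leq_add2l leqn0 cards_eq0 => /eqP/setP/(_ u).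
rewrite !inE => + wu; rewrite wu /= => /negbT; rewrite -leqNgt leq_eqVlt.
by rewrite eq_sym (negbTE (dist_edge_neq s wu)).
Qed.

Lemma uniq_size_le_card (r : seq T) : uniq r -> size r <= n.
Proof. by move=> /card_uniqP <-; exact: max_card. Qed.

Hypothesis order_ge5 : 5 <= n.

(** If [x] were the only neighbour of [v], then W(v,x) would be {v}, which forces n <= 3. *)
Lemma deg_ge2 v : 2 <= deg v.
Proof.
rewrite leqNgt ltnS; apply/negP => /card_le1_eqP deg1.
have [x vx] := connected_edge v (ltnW (ltnW (ltnW order_ge5))).
have /subset_leq_card : closer v x \subset [set v].
  apply/subsetP => y; rewrite !inE; apply: contraTT; rewrite eq_sym.
  case/dist_step => u vu yE; rewrite -leqNgt !(dist_sym _ y) yE.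
  by rewrite (deg1 u x) ?inE // leqnSn.
by rewrite cards1; have := card_closer_ge vx; move: order_ge5; lia.
Qed.

(** The truncated subtraction is exact because all degrees are at least 2. *)
Lemma sum_deg_excess : \sum_v (deg v - 2) + n.*2 = #|edges e|.*2.
Proof.
rewrite -card_darts -sum_deg -muln2 -sum_nat_const -big_split /=.
by apply: eq_bigr => v _; rewrite subnK ?deg_ge2.
Qed.

Lemma sum_down_excess s : \sum_(v | v != s) (down s v - 1) + n = #|edges e|.+1.
Proof.
have := sum_down s; rewrite (bigD1 s) //= down_src add0n => <-.
have -> : n = (\sum_(v | v != s) 1).+1.
  by rewrite sum1_card (eq_card (B := predC1 s)) // cardC1 prednK // (ltn_trans _ order_ge5).
rewrite addnS -big_split /=; congr _.+1; apply: eq_bigr => v nvs.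
by rewrite subnK ?down_gt0.
Qed.

Lemma card_setI_closer s x y : e s x -> e s y ->
  #|closer x s| + #|closer y s| < n + #|closer x s :&: closer y s|.
Proof.
move=> sx sy; rewrite -cardsUI ltn_add2r -cardsT proper_card //.
apply/properP; split; first exact: subsetT.
by exists s; rewrite // in_setU !(negbTE (src_notin_closer _ _)).
Qed.

Lemma edges_gt_order : n < #|edges e|.
Proof.
rewrite ltnNge; apply/negP => le_mn.
have deg2 v : deg v <= 2.
  have /= := @le_sum_term _ predT (fun v => deg v - 2) v isT.
  by have := sum_deg_excess; move: le_mn; card_lia.
have [t0 _] : exists t, t \in T by apply/card_gt0P; exact: leq_trans order_ge5.
pose s := [arg max_(t > t0) Tr t].
have Tr_max u : Tr u <= Tr s by rewrite /s; case: arg_maxnP => // t _; apply.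
have [x [y [/[!inE] sx sy nxy]]] := card_gt1P (deg_ge2 s).
(* The sum of [down s v - 1] is at most 1, so a single vertex [w] has two lower neighbours; having
   degree 2, it has no others. *)
have [w w_top down1] : exists2 w, forall u, e w u -> d s u < d s w
    & forall u, u != s -> u != w -> u != w -> down s u <= 1.
  have sumE := sum_down_excess s.
  have [/=|w /= nws /= w_gt] := @sum_nat_gt0_ex _ (fun v => v != s) (fun v => (down s v - 1)).
    by have := sum_deg_excess; move: sumE le_mn; card_lia.
  exists w => [u|u nus nuw _].
    by apply: deg_le_down; apply: leq_trans (deg2 w) _; case: (down s w) w_gt => [|[]].
  move: sumE; rewrite (bigD1 w) //= (bigD1 u) /= ?nus //.
  by have := sum_deg_excess; move: le_mn w_gt; card_lia.
(* With [q := w], a descent from any other vertex of the intersection would end at a vertex distinct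
   from [w] and equal to it. *)
have /subset_leq_card : closer x s :&: closer y s \subset [set w].
  apply/subsetP => v v_xy; rewrite inE; apply/negPn/negP => nvw.
  by have [_ _] := closer_inter sx sy nxy w_top down1 v_xy nvw; rewrite eqxx.
have [xs ys] : e x s /\ e y s by rewrite !(e_sym _ s).
(* By maximality of Tr(s) both sets have (n+1)/2 elements; as both miss [s], they share at least
   2. *)
rewrite cards1; have := card_setI_closer sx sy.
by have := card_closer_max xs (Tr_max x); have := card_closer_max ys (Tr_max y); lia.
Qed.

(** * The case m = n+1: a 4-cycle through two vertices of degree 3 *)

(** The sum of [down s v - 1] is 2, so there is either one vertex with three lower neighbours, which
    is then both [w] and [q], or two with two each. In the latter case the degree excess leaves one
    of them with degree 2, and this one is [w]. *)
Lemma late_merges s : #|edges e| = n.+1 -> \sum_(v | v != s) (deg v - 2) <= 1 ->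
  exists w q, [/\ forall u, e w u -> d s u < d s w,
    forall u, u != s -> u != w -> u != q -> down s u <= 1
    & q != w -> down s q <= 2].
Proof.
move=> mE; have := sum_down_excess s; rewrite mE => down_sum deg_sum.
have {}down_sum : \sum_(v | v != s) (down s v - 1) = 2 by lia.
have [/=|w /= nws /= w_gt] := @sum_nat_gt0_ex _ (fun v => v != s) (fun v => (down s v - 1)).
  by rewrite down_sum.
move: down_sum; rewrite (bigD1 w) //=.
have [w_ge3|w_lt3] := leqP 3 (down s w) => down_sum.
  exists w, w; split=> [u|u nus nuw _|]; last by rewrite eqxx.
    apply: deg_le_down; apply: leq_trans w_ge3.
    by have /= := @le_sum_term _ (fun v => v != s) (fun v => deg v - 2) w nws; lia.
  by move: down_sum; rewrite (bigD1 u) /= ?nus //; lia.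
have [/=|q /andP[nqs nqw] /= q_gt] := @sum_nat_gt0_ex _ (fun v => (v != s) && (v != w))
  (fun v => (down s v - 1)); first by lia.
move: down_sum; rewrite (bigD1 q) /= ?nqs // => down_sum.
have down1 u : u != s -> u != w -> u != q -> down s u <= 1.
  by move=> nus nuw nuq; move: down_sum; rewrite (bigD1 u) /= ?nus ?nuw //; lia.
move: deg_sum; rewrite (bigD1 w) // (bigD1 q) /= ?nqs // => deg_sum.
have [w_le2|w_gt2] := leqP (deg w) 2.
  exists w, q; split => // [u|_]; last by lia.
  by apply: deg_le_down; lia.
exists q, w; split => [u|u nus nuq nuw|_]; [|exact: down1|by lia].
by apply: deg_le_down; lia.
Qed.

(** Otherwise each intersection contains a vertex other than [w], so [q] lies in all three sets. Its
    steps towards [x], [y], [z] are distinct, since a common one would descend to [q] from below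
    [q]. This contradicts [down s q <= 2]. *)
Lemma thin_intersection s x y z : #|edges e| = n.+1 ->
    \sum_(v | v != s) (deg v - 2) <= 1 ->
    [/\ e s x, e s y & e s z] -> [/\ x != y, y != z & z != x] ->
  [|| #|closer x s :&: closer y s| <= 1, #|closer y s :&: closer z s| <= 1
    | #|closer z s :&: closer x s| <= 1].
Proof.
move=> mE deg_sum [sx sy sz] [nxy nyz nzx].
have [w [q [w_top down1 q_le2]]] := late_merges mE deg_sum.
have inter i j v si sj nij := @closer_inter s i j w q v si sj nij w_top down1.
have q_in i j : e s i -> e s j -> i != j ->
    ~~ (#|closer i s :&: closer j s| <= 1) -> q \in closer i s :&: closer j s /\ q != w.
  move=> si sj nij; rewrite -ltnNge => /card_gt1P[u [v [u_ij v_ij nuv]]].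
  have [uw|nuw] := eqVneq u w; last by have [] := inter i j u si sj nij u_ij nuw.
  have nvw : v != w by rewrite -uw eq_sym.
  by have [] := inter i j v si sj nij v_ij nvw.
apply/negPn/negP => /norP[xy /norP[yz zx]].
have [/setIP[qx qy] nqw] := q_in _ _ sx sy nxy xy.
have [/setIP[_ qz] _] := q_in _ _ sy sz nyz yz.
have neq_q i j : e s i -> e s j -> i != j -> q \in closer j s -> q != i.
  move=> si sj nij; apply: contraTneq => ->; rewrite inE -leqNgt leqNgt.
  by apply: contraNN nij => ij; rewrite (dist_nbr sj si ij).
have [p1 p1x [qp1 sp1]] := closer_step sx qx (neq_q _ _ sx sy nxy qy).
have [p2 p2y [qp2 sp2]] := closer_step sy qy (neq_q _ _ sy sz nyz qz).
have [p3 p3z [qp3 sp3]] := closer_step sz qz (neq_q _ _ sz sx nzx qx).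
have no_common i j p : e s i -> e s j -> i != j -> e q p -> d s p < d s q ->
    p \in closer i s -> p \in closer j s -> False.
  move=> si sj nij qp lt_p pi pj.
  have npw : p != w.
    by apply: contraTneq lt_p => pE; rewrite -leqNgt ltnW // pE w_top // -pE e_sym.
  have [|_ le_q _] := inter i j p si sj nij _ npw; first exact/setIP.
  by have := leq_trans lt_p le_q; rewrite ltnn.
have /card_gt2P : exists u v t, [/\ u \in [set u | e q u & d s u < d s q],
  v \in [set u | e q u & d s u < d s q] & t \in [set u | e q u & d s u < d s q]]
  /\ [/\ u != v, v != t & t != u].
  exists p1, p2, p3; rewrite !inE qp1 qp2 qp3 sp1 sp2 sp3; split => //.
  split; apply/eqP => pE.
  - by rewrite -pE in p2y; case: (no_common x y p1).
  - by rewrite -pE in p3z; case: (no_common y z p2).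
  - by rewrite -pE in p1x; case: (no_common z x p3).
by apply/negP; rewrite -leqNgt; exact: q_le2.
Qed.

(* Inclusion-exclusion: the two sets cover all vertices but [s] and [l]. *)
Lemma four_cycle s i j l : e s i -> e s j -> e s l -> i != j -> l != i -> l != j ->
    #|closer i s :&: closer j s| <= 1 ->
  exists b z, [/\ b \in [set i; j], e l z, e b z & z != s].
Proof.
move=> si sj sl nij nli nlj inter1.
have [z z_nbr] : exists z, z \in nbr l :\ s.
  apply/card_gt0P; have := deg_ge2 l.
  by rewrite /deg (cardsD1 s); case: (s \in _) => //=; clear; lia.
move: z_nbr; rewrite !inE => /andP[nzs lz].
have nz1 : d s z != 1 by rewrite eq_sym -(dist_edge sl) dist_edge_neq.
have z2 : d s z <= 2 by have := dist_edge_le s lz; rewrite (dist_edge sl).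
have nz0 : d s z != 0 by rewrite dist_eq0 eq_sym.
have z_ij : z \in closer i s :|: closer j s.
  (* Otherwise the union misses [s], [l] and [z], while its size is at least (n-1) - 1. *)
  apply/negPn/negP => nz.
  have : closer i s :|: closer j s \subset ~: [set s; l; z].
    apply/subsetP => v v_ij; rewrite !inE negb_or negb_or -andbA; apply/and3P; split.
    - by apply: contraTneq v_ij => ->; rewrite inE !(negbTE (src_notin_closer _ _)).
    - apply: contraTneq v_ij => ->; rewrite !inE negb_or.
      by apply/andP; split; [move: nli | move: nlj]; apply: contraNN;
        [move/(dist_nbr si sl) | move/(dist_nbr sj sl)] => ->.
    - by apply: contraTneq v_ij => ->.
  move/subset_leq_card.
  have nsl : s != l by apply: contraTneq sl => ->; rewrite e_irr.
  have nlz : l != z by apply: contraTneq lz => ->; rewrite e_irr.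
  have := cardsC [set s; l; z]; rewrite cards3 ?(eq_sym s z) //.
  have := card_closer_ge (u := i) (v := s); have := card_closer_ge (u := j) (v := s).
  rewrite !(e_sym _ s) => /(_ sj) + /(_ si).
  have := cardsUI (closer i s) (closer j s); move: inter1 order_ge5.
  by card_lia.
have [b b_ij z_b] : exists2 b, b \in [set i; j] & z \in closer b s.
  by case/setUP: z_ij => z_b; [exists i | exists j]; rewrite // !inE eqxx ?orbT.
have sb : e s b by case/set2P: b_ij => ->.
exists b, z; split => //; apply: dist1; move: z_b; rewrite inE.
have : d b z != 0; last by move: nz1 z2; clear; lia.
by rewrite dist_eq0; apply: contraNneq nz1 => <-; rewrite dist_edge.
Qed.

(** The pair [a], [z] can be left only through [s] or [b]. As [b] is adjacent to [s], a vertex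
    reached through [b] is no closer to [a] than to [s]. *)
Lemma closer_in_four_cycle s a b z : e s a -> e s b -> e z a -> e z b -> a != b ->
  deg a <= 2 -> deg z <= 2 -> s != z -> closer a s \subset [set a; z].
Proof.
move=> sa sb za zb nab a2 z2 nsz.
have nbr_a : nbr a = [set s; z].
  by apply: nbr_eq; rewrite ?cards2 ?nsz //; apply/subsetP => u /set2P[]->; rewrite inE e_sym.
have nbr_z : nbr z = [set a; b].
  by apply: nbr_eq; rewrite ?cards2 ?nab //; apply/subsetP => u /set2P[]->; rewrite inE.
apply/subsetP => v; rewrite !inE; apply: contraTT; rewrite negb_or -leqNgt => /andP[nva nvz].
rewrite !(dist_sym _ v).
rewrite eq_sym in nva; rewrite eq_sym in nvz.
have [u + ->] := dist_step nva.
have -> : e a u = (u \in nbr a) by rewrite inE.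
rewrite nbr_a => /set2P[]->; first exact: leqnSn.
have [u' + ->] := dist_step nvz.
have -> : e z u' = (u' \in nbr z) by rewrite inE.
rewrite nbr_z => /set2P[]->.
  have := dist_edge_le v sa; have := dist_edge_le v (_ : e a s).
  by rewrite e_sym => /(_ sa); clear; lia.
by have := dist_edge_le v (_ : e b s); rewrite e_sym => /(_ sb); clear; lia.
Qed.

(** If [z] had degree 2, then, as [a] or [b] also has degree 2, some W(a,s) or W(b,s) would have at
    most two elements, so n <= 5. But a second neighbour [u] of [c] yields six distinct vertices. *)
Lemma four_cycle_deg s a b c z : \sum_(v | v != s) (deg v - 2) <= 1 ->
  e s a -> e s b -> e s c -> e z a -> e z b -> z != s -> a != b -> c != a -> c != b ->
  2 < deg z.
Proof.
move=> deg_sum sa sb sc za zb nzs nab nca ncb; rewrite ltnNge; apply/negP => z2.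
have small x y : e s x -> e s y -> e z x -> e z y -> x != y -> deg x <= 2 -> n <= 5.
  move=> sx sy zx zy nxy x2.
  have nsz : s != z by rewrite eq_sym.
  have := subset_leq_card (closer_in_four_cycle sx sy zx zy nxy x2 z2 nsz).
  rewrite cards2; have := @card_closer_ge x s; rewrite e_sym => /(_ sx).
  by case: eqP => _ /=; card_lia.
have nbr_neq_s x : e s x -> x != s by apply: contraTneq => ->; rewrite e_irr.
have n5 : n <= 5.
  have [a2|a_gt2] := leqP (deg a) 2; first exact: (small a b).
  apply: (small b a) => //; first by rewrite eq_sym.
  move: deg_sum; rewrite (bigD1 a) ?nbr_neq_s //= (bigD1 b) /= ?nbr_neq_s 1?eq_sym //.
  by move: a_gt2; card_lia.
have [u] : exists u, u \in nbr c :\ s.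
  apply/card_gt0P; have := deg_ge2 c.
  by rewrite /deg (cardsD1 s); case: (s \in _) => //=; clear; lia.
rewrite !inE => /andP[nus cu].
have nuN x : e s x -> u != x.
  move=> sx; apply: contraNneq (dist_edge_neq s cu) => ->.
  by rewrite !dist_edge.
have nzN x : e s x -> e z x -> z != x by move=> _; apply: contraTneq => ->; rewrite e_irr.
have [uz|nuz] := eqVneq u z.
  have : [set a; b; c] \subset nbr z.
    by apply/subsetP => x; rewrite !inE -orbA => /or3P[] /eqP-> //; rewrite -uz e_sym.
  by move/subset_leq_card; rewrite cards3 ?(eq_sym _ c) // leqNgt ltnS z2.
have nzc : z != c.
  apply/eqP => zc; have := dist_edge_neq s za.
  by rewrite zc !dist_edge.
have : uniq [:: u; z; s; a; b; c].
  rewrite /= !inE !negb_or nuz nus !nuN // nzs nzc !nzN //.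
  by rewrite !(eq_sym s) !nbr_neq_s // nab !(eq_sym _ c) nca ncb.
by move/uniq_size_le_card => /= n6; move: (leq_trans n6 n5).
Qed.

Lemma hat_structure : #|edges e| = n.+1 ->
  exists s z a b, [/\ [/\ e s a, e s b, e z a & e z b], a != b, s != z,
    deg s = 3 /\ deg z = 3 & forall v, v != s -> v != z -> deg v = 2].
Proof.
move=> mE; have deg_sum : \sum_v (deg v - 2) = 2.
  by have := sum_deg_excess; rewrite mE; card_lia.
have [|s _ /= s_gt] := @sum_nat_gt0_ex _ predT (fun v => deg v - 2).
  by rewrite deg_sum.
have {s_gt} s3 : 2 < deg s by move: s_gt; clear; lia.
have deg_sum' : deg s - 2 + \sum_(v | v != s) (deg v - 2) = 2.
  by move: deg_sum; rewrite (bigD1 s).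
have sum_le1 : \sum_(v | v != s) (deg v - 2) <= 1 by move: deg_sum' s3; card_lia.
have [z [a [b [c [[sa sb sc] [za zb nzs] [nab nca ncb]]]]]] : exists z a b c,
    [/\ [/\ e s a, e s b & e s c], [/\ e z a, e z b & z != s]
      & [/\ a != b, c != a & c != b]].
  have [x [y [t [/[!inE] sxyt nxyt]]]] := card_gt2P s3.
  (* The 4-cycle runs through [l] and one of [i], [j]; the other one serves as [c]. *)
  have from_pair i j l : e s i -> e s j -> e s l -> i != j -> l != i -> l != j ->
      #|closer i s :&: closer j s| <= 1 -> exists z a b c,
      [/\ [/\ e s a, e s b & e s c], [/\ e z a, e z b & z != s]
        & [/\ a != b, c != a & c != b]].
    move=> si sj sl nij nli nlj inter1.
    have [b [z [/set2P[]-> lz bz nzs]]] := four_cycle si sj sl nij nli nlj inter1.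
      by exists z, l, i, j; split; split; rewrite // 1?e_sym // 1?eq_sym //.
    by exists z, l, j, i; split; split; rewrite // 1?e_sym // 1?eq_sym //.
  have [sx sy st] := sxyt; have [nxy nyt ntx] := nxyt.
  case/or3P: (thin_intersection mE sum_le1 sxyt nxyt) => [xy|yt|tx].
  - by apply: (from_pair x y t) => //; rewrite eq_sym.
  - by apply: (from_pair y t x) => //; rewrite eq_sym.
  - by apply: (from_pair t x y) => //; rewrite eq_sym.
have z3 := four_cycle_deg sum_le1 sa sb sc za zb nzs nab nca ncb.
exists s, z, a, b; split => //; first by rewrite eq_sym.
  by move: deg_sum'; rewrite (bigD1 z) //=; move: s3 z3; card_lia.
move=> v nvs nvz; have := deg_ge2 v; move: deg_sum'.
rewrite (bigD1 z) //= (bigD1 v) /= ?nvs //.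
by move: s3 z3; card_lia.
Qed.

(** * The case m = n+1: closing the long cycle *)

(** The list [r] holds the vertices to be avoided. A path is extended while its end has a neighbour
    off the list, at most n times. *)
Lemma maximal_path (r : seq T) z : uniq (r ++ [:: z]) ->
  exists p, [/\ path e z p, uniq (r ++ z :: p)
    & forall u, e (last z p) u -> u \in r ++ z :: p].
Proof.
move=> uniq_r; suff ext k p : n - size p <= k -> path e z p -> uniq (r ++ z :: p) ->
    exists p, [/\ path e z p, uniq (r ++ z :: p)
    & forall u, e (last z p) u -> u \in r ++ z :: p] by exact: (ext n [::]) (leq_subr _ _) _ _.
elim: k p => [|k IH] p le_k p_path p_uniq.
  have := uniq_size_le_card p_uniq; move: le_k; rewrite size_cat /=; clear; lia.
have [/exists_inP[u pu nu]|] := boolP [exists u in nbr (last z p), u \notin r ++ z :: p].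
  apply: (IH (rcons p u)); last by rewrite -rcons_cons -rcons_cat rcons_uniq nu.
    by rewrite size_rcons; move: le_k; clear; lia.
  by rewrite rcons_path p_path; rewrite inE in pu.
move=> /exists_inPn p_max; exists p; split => // u pu; apply/negPn/p_max.
by rewrite inE.
Qed.

(** The cycle is [s], [a], [z] followed by [p], and [b] is the hat; [p] comes from a maximal path
    that starts at [z] and avoids [b], [s], [a]. *)
Lemma hat_cycle s z a b :
    [/\ e s a, e s b, e z a & e z b] -> a != b -> s != z -> deg s = 3 -> deg z = 3 ->
    (forall v, v != s -> v != z -> deg v = 2) ->
  exists p, [/\ path e z p, e (last z p) s, uniq [:: b, s, a, z & p]
    & forall v, v \in [:: b, s, a, z & p]].
Proof.
move=> [sa sb za zb] nab nsz s3 z3 deg2.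
have e_neq x y : e x y -> x != y by apply: contraTneq => ->; rewrite e_irr.
have sym x y : e x y -> e y x by rewrite e_sym.
have nbr_ab c : e s c -> e z c -> nbr c = [set s; z].
  move=> sc zc; apply: nbr_eq; last by rewrite cards2 nsz deg2 // eq_sym e_neq.
  by apply/subsetP => u /set2P[]->; rewrite inE e_sym.
have nsz_edge : ~~ e s z.
  by apply/negP => /dist_edge sz1; have := dist_edge_neq s za; rewrite sz1 dist_edge.
have [|p [p_path p_uniq p_max]] := @maximal_path [:: b; s; a] z.
  rewrite /= !inE !negb_or nsz (e_neq s a) // (eq_sym b s) (e_neq s b) //.
  rewrite (eq_sym b a) nab (eq_sym b z) (e_neq z b) // (eq_sym a z) (e_neq z a) //.
rewrite /= in p_uniq p_max; exists p.
have not_end x : x \in p -> x != s /\ x != z.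
  move=> xp; move: p_uniq; rewrite !inE !negb_or => /and5P[_ /and3P[_ _ sp] _ zp _].
  by split; [apply: contraNneq sp => <- | apply: contraNneq zp => <-].
have nbr_s x : e s x -> x != a -> x != b -> nbr s = [set a; b; x].
  move=> sx nxa nxb; apply: nbr_eq; last by rewrite cards3 ?s3 // eq_sym.
  by apply/subsetP => u; rewrite !inE -orbA => /or3P[] /eqP->.
have nbr_z x : e z x -> x != a -> x != b -> nbr z = [set a; b; x].
  move=> zx nxa nxb; apply: nbr_eq; last by rewrite cards3 ?z3 // eq_sym.
  by apply/subsetP => u; rewrite !inE -orbA => /or3P[] /eqP->.
have nbr2 x u v : x \in p -> e x u -> e x v -> u != v -> nbr x = [set u; v].
  move=> /not_end[nxs nxz] xu xv nuv; apply: nbr_eq; last by rewrite cards2 nuv deg2.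
  by apply/subsetP => w /set2P[]->; rewrite inE.
have p_notab x : x \in p -> x != a /\ x != b.
  move=> xp; move: p_uniq; rewrite !inE !negb_or => /and5P[/and4P[_ _ _ bp] _ /andP[_ ap] _ _].
  by split; [apply: contraNneq ap => <- | apply: contraNneq bp => <-].
(* The last vertex of the path has a second neighbour; every vertex other
   than [s] already has all its neighbours. *)
have closing : e (last z p) s.
  case/lastP: p => [|p x] in p_path p_uniq p_max not_end nbr2 p_notab *.
    have : nbr z \subset [set a; b].
      apply/subsetP => u; rewrite inE => zu; have := p_max u zu.
      rewrite !inE => /or4P[] /eqP uE; rewrite uE ?eqxx ?orbT //.
        by rewrite e_sym -uE zu in nsz_edge.
      by rewrite uE e_irr in zu.
    by move/subset_leq_card; rewrite cards2 nab -/(deg z) z3.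
  rewrite last_rcons in p_max *; move: p_path; rewrite rcons_path => /andP[p_path yx].
  have xp : x \in rcons p x by rewrite mem_rcons mem_head.
  have [nxs nxz] := not_end x xp.
  have /card_gt0P[u] : 0 < #|nbr x :\ last z p|.
    by have := deg2 x nxs nxz; rewrite /deg (cardsD1 (last z p)) inE e_sym yx add1n => -[->].
  rewrite !inE => /andP[nuy xu].
  have := p_max u xu; rewrite 3!inE -rcons_cons mem_rcons => /or4P[/eqP uE|/eqP<- //|/eqP uE|].
  - have : x \in nbr b by rewrite inE -uE e_sym.
    by rewrite nbr_ab // !inE (negbTE nxs) (negbTE nxz).
  - have : x \in nbr a by rewrite inE -uE e_sym.
    by rewrite nbr_ab // !inE (negbTE nxs) (negbTE nxz).
  case/predU1P => [ux|/predU1P[uz|up]]; first by rewrite ux e_irr in xu.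
    subst u; case: p => [|y p] in p_path p_uniq p_max not_end nbr2 p_notab nuy xp yx *.
      by rewrite eqxx in nuy.
    have y_p : y \in rcons (y :: p) x by rewrite mem_head.
    have [nya nyb] := p_notab y y_p.
    have zy : e z y by case/andP: p_path.
    have : x \in nbr z by rewrite inE e_sym.
    have [nxa nxb] := p_notab x xp.
    rewrite (nbr_z y) // !inE (negbTE nxa) (negbTE nxb) /= => /eqP xy.
    move: p_uniq; rewrite xy /= mem_rcons mem_head /= !andbF.
    by [].
  case/splitPr: up => p1 p2 in p_path p_uniq p_max not_end nbr2 p_notab nuy xp yx *.
  case: p2 => [|y p2] in p_path p_uniq p_max not_end nbr2 p_notab nuy xp yx *.
    by rewrite last_cat /= eqxx in nuy.
  have u_p : u \in rcons (p1 ++ [:: u, y & p2]) x.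
    by rewrite mem_rcons inE mem_cat mem_head !orbT.
  move: p_path; rewrite cat_path /= => /and4P[_ p1u uy _].
  have : uniq ((z :: p1) ++ [:: u, y & rcons p2 x]).
    by move: p_uniq; rewrite rcons_cat => /and4P[].
  rewrite cat_uniq => /and3P[_ /hasPn p1N /and3P[_ y_notin _]].
  have nxy : x != y by apply: contraNneq y_notin => <-; rewrite mem_rcons mem_head.
  have nly : y != last z p1.
    by apply: contraNneq (p1N y _) => [->|]; rewrite ?mem_last // !inE eqxx orbT.
  have nlx : x != last z p1.
    apply: contraNneq (p1N x _) => [->|]; first exact: mem_last.
    by rewrite !inE mem_rcons mem_head !orbT.
  have : x \in nbr u by rewrite inE e_sym.
  by rewrite (nbr2 u y (last z p1)) 1?e_sym // 1?e_sym // !inE (negbTE nxy) (negbTE nlx).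
have lp : last z p \in p.
  case: p closing {p_uniq p_max p_path not_end nbr2 p_notab} => [|y p].
    by rewrite /= e_sym (negbTE nsz_edge).
  by rewrite /= mem_last.
have [nla nlb] := p_notab _ lp.
set L := [:: b, s, a, z & p].
have L_p x : x \in z :: p -> x \in L by move=> x_zp; rewrite 3!in_cons x_zp !orbT.
(* The known degrees show that all neighbours of vertices of [L] are in [L]; by connectedness, [L]
   then contains every vertex. *)
have L_closed x y : e x y -> x \in L -> y \in L.
  move=> xy xL; have {xy} : y \in nbr x by rewrite inE.
  case/predU1P: xL => [xE|/predU1P[xE|/predU1P[xE|/predU1P[xE|xp]]]].
  - by rewrite xE nbr_ab // => /set2P[]->; rewrite !inE eqxx ?orbT.
  - rewrite xE (nbr_s (last z p)) 1?e_sym // !inE -orbA.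
    case/or3P=> /eqP->; rewrite ?eqxx ?orbT //.
    by rewrite lp !orbT.
  - by rewrite xE nbr_ab // => /set2P[]->; rewrite !inE eqxx ?orbT.
  - have [y' y'p zy'] : exists2 y', y' \in p & e z y'.
      case: p p_path lp {p_uniq p_max not_end nbr2 p_notab closing nla nlb L L_p} => // y' p.
      by case/andP => zy' _ _; exists y'; rewrite ?mem_head.
    have [nya nyb] := p_notab y' y'p.
    rewrite xE (nbr_z y') // !inE -orbA => /or3P[] /eqP->; rewrite ?eqxx ?orbT //.
    by rewrite y'p !orbT.
  - have [nxs nxz] := not_end x xp.
    case/splitPr: xp {lp} => p1 p2 in p_path p_uniq not_end nbr2 p_notab closing nla nlb L L_p *.
    have xp : x \in p1 ++ x :: p2 by rewrite mem_cat mem_head orbT.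
    have l1 : last z p1 \in L.
      by apply: L_p; rewrite -cat_cons mem_cat mem_last.
    move: p_path; rewrite cat_path /= => /and3P[_ p1x p2_path].
    case: p2 => [|y' p2] in p2_path p_uniq not_end nbr2 p_notab closing nla nlb xp L L_p l1 *.
      rewrite last_cat /= in closing.
      rewrite (nbr2 x s (last z p1)) // 1?e_sym //.
        by move/set2P => [->|-> //]; rewrite !inE eqxx ?orbT.
      apply: contraTneq (mem_last z p1) => <-; rewrite inE (negbTE nsz) /=.
      by apply/negP => sp; case: (not_end s); rewrite ?eqxx // mem_cat sp.
    have : uniq ((z :: p1) ++ [:: x, y' & p2]) by case/and4P: p_uniq.
    rewrite cat_uniq => /and3P[_ /hasPn p1N _].
    have nly : y' != last z p1.
      by apply: contraNneq (p1N y' _) => [->|]; rewrite ?mem_last // !inE eqxx orbT.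
    have xy' : e x y' by case/andP: p2_path.
    rewrite (nbr2 x y' (last z p1)) // 1?e_sym //.
    by move/set2P => [->|-> //]; apply: L_p; rewrite !inE mem_cat !inE eqxx !orbT.
have walk q x : path e x q -> x \in L -> last x q \in L.
  elim: q x => [//|y q IH] x; rewrite [path _ _ _]/= => /andP[xy yq] xL.
  exact: IH yq (L_closed _ _ xy xL).
split => // v; have /connectP[q q_path ->] := e_conn s v.
by apply: walk => //; rewrite !inE eqxx orbT.
Qed.

Lemma isomorphic_hatted_cycle : #|edges e| = n.+1 ->
  #|darts (hatted_cycle n)| = n.+1.*2 -> isomorphic e (hatted_cycle n).
Proof.
move=> mE darts_hat.
have [s [z [a [b [adj nab nsz [s3 z3] deg2]]]]] := hat_structure mE.
have [p [p_path closing p_uniq p_all]] := hat_cycle adj nab nsz s3 z3 deg2.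
have [sa sb za zb] := adj.
(* Thus v_1 = [s], v_2 = [a], v_3 = [z], and [b], put last, is the hat v_n. *)
pose q := [:: s, a, z & p]; pose g (i : 'I_n) := nth b (rcons q b) i.
have size_q : size q = n.-1.
  have <- : size (b :: q) = n.
    by rewrite -(card_uniqP p_uniq); apply: eq_card => v; rewrite p_all.
  by [].
have q_lt i : i < n.-1 -> nth b (rcons q b) i = nth b q i.
  by move=> lt_i; rewrite nth_rcons size_q lt_i.
have g_inj : injective g.
  move=> i j /eqP; rewrite nth_uniq ?rcons_uniq ?size_rcons ?size_q //; last first.
  - by rewrite prednK // (leq_trans _ order_ge5).
  - by rewrite prednK // (leq_trans _ order_ge5).
  by move/eqP/val_inj.
have q_path : path e s [:: a, z & p] by rewrite /= sa e_sym za.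
have g_cyc (i j : 'I_n) : [&& i < n.-1, j < n.-1 & j == i.+1 %% n.-1 :> nat] ->
    e (g i) (g j).
  case/and3P => lt_i lt_j /eqP jE; rewrite /g !q_lt //.
  move: (lt_i); rewrite leq_eqVlt => /predU1P[iE|lt_i1].
    have -> : nth b q i = last s q.
      by rewrite -nth_last size_q -iE; apply: set_nth_default; rewrite size_q.
    by rewrite jE iE modnn.
  rewrite jE modn_small // [nth b q i](set_nth_default s) ?size_q //.
  rewrite [nth b q i.+1](set_nth_default s) ?size_q //.
  by have /(pathP s) := q_path; apply; move: lt_i1; rewrite -size_q.
have g_hat (i j : 'I_n) : (i == n.-1 :> nat) && ((j == 0 :> nat) || (j == 2 :> nat)) ->
    e (g i) (g j).
  case/andP => /eqP iE jE; rewrite /g iE nth_rcons size_q ltnn eqxx.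
  by case/orP: jE => /eqP-> /=; rewrite e_sym.
apply: (isomorphic_card_darts (g := g)).
- by apply: inj_card_bij => //; rewrite card_ord.
- move=> i j /or4P[ij|ji|ij|ji]; [exact: g_cyc | | exact: g_hat |]; rewrite e_sym.
    exact: g_cyc.
  exact: g_hat.
- by rewrite darts_hat card_darts mE.
Qed.

End Distance.

(** * Passage from rational to natural bounds, and assembly *)

Theorem theorem2p1 (T : finType) (e : rel T) (n m : nat)
    (hsimple : simple_graph e) (hconn : connected_graph e)
    (hn : #|T| = n) (hm : #|edges e| = m) (hsti : sti e) :
  [/\ (5 <= n)%N -> (n + 1 <= m)%N,
      (m%:R <= (n%:R ^+ 2 - 1) / 4 :> rat)%R,
      (5 <= n)%N -> (m = (n + 1)%N <-> isomorphic e (hatted_cycle n)) &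
      (m%:R = (n%:R ^+ 2 - 1) / 4 :> rat)%R <->
        isomorphic e (complete_bipartite n.-1./2 n.+1./2)].
Proof.
have [e_sym e_irr] := hsimple; have [n_gt0 e_conn] := hconn.
have le_rat k l : (k%:R <= (l%:R ^+ 2 - 1) / 4 :> rat)%R = (k.*2.*2.+1 <= l ^ 2).
  by rewrite ler_pdivlMr ?ltr0n // lerBrDr -natrX -natrM natr1 ler_nat -!muln2 -mulnA.
have eq_rat k l : (k%:R = (l%:R ^+ 2 - 1) / 4 :> rat)%R <-> k.*2.*2.+1 = l ^ 2.
  apply: (iff_trans (rwP eqP)); apply: (iff_trans _ (iff_sym (rwP eqP))).
  have nz4 : (4 != 0 :> rat)%R by rewrite pnatr_eq0.
  rewrite -(inj_eq (mulIf nz4)) divfK // eq_sym subr_eq eq_sym.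
  by rewrite -natrX -natrM natr1 eqr_nat -!muln2 -mulnA.
have darts_m := card_darts e_sym e_irr.
subst n m; split.
- by move=> n_ge5; rewrite addn1 edges_gt_order.
- by rewrite le_rat card_edges_max.
- move=> n_ge5; rewrite addn1; split=> [mE | /card_darts_iso].
    by apply: isomorphic_hatted_cycle; rewrite ?card_darts_hatted_cycle.
  by rewrite card_darts_hatted_cycle // darts_m => /double_inj.
- apply: (iff_trans (eq_rat _ _)); split=> [mE | /card_darts_iso].
    exact: isomorphic_complete_bipartite.
  rewrite card_darts_complete_bipartite darts_m => /double_inj->.
  (* Since n = 2k+1, the halves are exactly k and k+1, and 4k(k+1) + 1 = n^2. *)
  have odd_n := odd_card e_sym e_conn hsti n_gt0.
  have [k ->] : exists k, #|T| = k.*2.+1.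
    by exists #|T|./2; rewrite -[LHS]odd_double_half odd_n.
  by rewrite -doubleS !doubleK expnS expn1; clear; nia.
Qed.
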